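(* Let $Sol_3$ be $\mathbb{R}^3$ with coordinates $(x^1,x^2,x^3)$ and the Riemannian metric $g_{Sol}=e^{2x^3}(dx^1)^2+e^{-2x^3}(dx^2)^2+(dx^3)^2$, with the orthonormal frame $e_1=e^{-x^3}\partial_{x^1}$, $e_2=e^{x^3}\partial_{x^2}$, $e_3=\partial_{x^3}$. Let $V=xe_1+ye_2+ze_3$ be a left-invariant unit vector field, i.e. $x,y,z$ are real constants with $x^2+y^2+z^2=1$. Then: (1) $V$ is a harmonic unit section if and only if either $V=\pm e_3$ or $V\in e_3^{\perp}$ (i.e. $z=0$). (2) $V$ is a non-harmonic biharmonic unit section (a biharmonic unit section that is not a harmonic unit section) if and only if its coordinates lie on one of the circles $\{z=\tfrac1{\sqrt2},\ x^2+y^2=\tfrac12\}$ and $\{z=-\tfrac1{\sqrt2},\ x^2+y^2=\tfrac12\}$.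
   Context: Let $(M,g)$ be a Riemannian manifold with Levi-Civita connection $\nabla$. For a local orthonormal frame $\{e_i\}$ and a smooth vector field $V$ set $\bar\Delta V=\sum_i(\nabla_{\nabla_{e_i}e_i}V-\nabla_{e_i}\nabla_{e_i}V)$. For a unit vector field $V$, the vertical energy and vertical bienergy over a compact domain $D$ are $E_1^v(V;D)=\frac12\int_D\|\nabla V\|^2v_g$ and $E_2^v(V;D)=\frac12\int_D\{g(\bar\Delta V,\bar\Delta V)-g(\bar\Delta V,V)^2\}v_g$. $V$ is a harmonic unit section (resp. biharmonic unit section) if it is a critical point of $E_1^v$ (resp. $E_2^v$) with respect to smooth variations through unit vector fields (supported in compact domains when $M$ is non-compact). The known characterizations, valid on any Riemannian manifold and used as the working definition, are: $V$ is a harmonic unit section if and only if $\bar\Delta V$ is pointwise collinear to $V$; $V$ is a biharmonic unit section if and only if $\bar\Delta[\bar\Delta V-g(\bar\Delta V,V)V]-g(\bar\Delta V,V)\bar\Delta V$ is pointwise collinear to $V$. *)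

(* Defs.v *)
From HB Require Import structures.
From mathcomp Require Import all_boot all_order all_algebra.
From mathcomp Require Import all_classical all_reals all_analysis.
From mathcomp Require Import ring.

Set Implicit Arguments.
Unset Strict Implicit.
Unset Printing Implicit Defensive.

Import Order.TTheory GRing.Theory Num.Theory.
Import numFieldNormedType.Exports.
Local Open Scope classical_set_scope.
Local Open Scope ring_scope.

(* Riemannian geometry of R^(n+1) in its global coordinates.  A vector at a
   point is the row of its components in the coordinate frame d/dx^1, ...,
   d/dx^(n+1); a metric is the field of its Gram matrices in that frame. *)
Section Coordinates.
Context {R : realType} {n : nat}.

Definition vfield : Type := 'rV[R]_n.+1 -> 'rV[R]_n.+1.
Definition metric : Type := 'rV[R]_n.+1 -> 'M[R]_n.+1.
Definition frame : Type := 'I_n.+1 -> vfield.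

Implicit Types (g : metric) (X Y V W : vfield) (E : frame) (p : 'rV[R]_n.+1).

Definition partial (i : 'I_n.+1) (f : 'rV[R]_n.+1 -> R) : 'rV[R]_n.+1 -> R :=
  fun p => 'D_(delta_mx 0 i) f p.

(* C^oo: every iterated partial derivative, including f itself, is
   differentiable everywhere. *)
Definition smooth (f : 'rV[R]_n.+1 -> R) : Prop :=
  forall (s : seq 'I_n.+1) p, differentiable (foldr partial f s) p.

Definition smooth_vfield V : Prop := forall k, smooth (fun p => V p 0 k).

Definition inner g p (u v : 'rV[R]_n.+1) : R := (u *m g p *m v^T) 0 0.

Definition riemannian_metric g : Prop :=
  [/\ forall i j, smooth (fun p => g p i j),
      forall p, (g p)^T = g p
    & forall p (u : 'rV[R]_n.+1), u != 0 -> 0 < inner g p u u].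

(* Gamma^k_ij.  That nabla below is the Levi-Civita connection of g is checked
   by nabla_torsion_free and nabla_metric. *)
Definition christoffel g (k i j : 'I_n.+1) p : R :=
  2^-1 * \sum_l invmx (g p) k l *
    (partial i (fun q => g q l j) p + partial j (fun q => g q l i) p
     - partial l (fun q => g q i j) p).

Definition nabla g X Y : vfield := fun p =>
  \row_k (\sum_i X p 0 i * partial i (fun q => Y q 0 k) p
          + \sum_i \sum_j christoffel g k i j p * X p 0 i * Y p 0 j).

Definition orthonormal_frame g E : Prop :=
  (forall i, smooth_vfield (E i)) /\
  (forall p i j, inner g p (E i p) (E j p) = (i == j)%:R).

(* - tr_g of the Hessian of V.  For Riemannian g and smooth V it does not depend
   on the orthonormal frame E: see rough_laplacian_frame. *)
Definition rough_laplacian g E V : vfield := fun p =>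
  \sum_i (nabla g (nabla g (E i) (E i)) V p
          - nabla g (E i) (nabla g (E i) V) p).

Definition unit_vfield g V : Prop :=
  smooth_vfield V /\ forall p, inner g p (V p) (V p) = 1.

Definition collinear_to W V : Prop := forall p, exists c : R, W p = c *: V p.

(* Critical points of the vertical energy (resp. bienergy) for variations through
   unit vector fields, in Euler-Lagrange form. *)
Definition harmonic_unit_section g E V : Prop :=
  unit_vfield g V /\ collinear_to (rough_laplacian g E V) V.

Definition biharmonic_unit_section g E V : Prop :=
  let DV := rough_laplacian g E V in
  let f := fun p => inner g p (DV p) (V p) in
  unit_vfield g V /\
  collinear_to
    (fun p => rough_laplacian g E (fun q => DV q - f q *: V q) p - f p *: DV p)
    V.

End Coordinates.

Arguments vfield : clear implicits.
Arguments metric : clear implicits.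
Arguments frame : clear implicits.

Section Geometry.
Context {R : realType} {n : nat}.
Implicit Types (g : metric R n) (X Y Z V : vfield R n) (E F : frame R n).
Implicit Types (f h : 'rV[R]_n.+1 -> R) (p : 'rV[R]_n.+1).

Lemma smooth_differentiable f p : smooth f -> differentiable f p.
Proof. by move=> /(_ [::] p). Qed.

Lemma smooth_partial i f : smooth f -> smooth (partial i f).
Proof. by move=> sf s p; have := sf (rcons s i) p; rewrite foldr_rcons. Qed.

Lemma partialM i f h p : differentiable f p -> differentiable h p ->
  partial i (fun q => f q * h q) p = partial i f p * h p + f p * partial i h p.
Proof.
move=> df dh; rewrite /partial deriveM; try exact: diff_derivable.
by rewrite addrC /GRing.scale /= [h p * _]mulrC.
Qed.

Lemma differentiable_sumf (I : Type) (r : seq I) (f : I -> 'rV[R]_n.+1 -> R) p :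
  (forall i, differentiable (f i) p) ->
  differentiable (fun q => \sum_(i <- r) f i q) p.
Proof.
move=> df; elim: r => [|i r IH].
  rewrite (_ : (fun _ => _) = cst 0) //; last by apply/funext => q; rewrite big_nil.
rewrite (_ : (fun _ => _) = f i + (fun q => \sum_(j <- r) f j q)).
  exact: differentiableD.
by apply/funext => q; rewrite big_cons.
Qed.

Lemma partial_sum (I : Type) (r : seq I) (f : I -> 'rV[R]_n.+1 -> R) j p :
  (forall i, differentiable (f i) p) ->
  partial j (fun q => \sum_(i <- r) f i q) p = \sum_(i <- r) partial j (f i) p.
Proof.
move=> df; elim: r => [|i r IH].
  rewrite big_nil (_ : (fun _ => _) = cst 0) /partial ?derive_cst //.
  by apply/funext => q; rewrite big_nil.
rewrite big_cons -IH (_ : (fun _ => _) = f i + (fun q => \sum_(j <- r) f j q)).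
  rewrite /partial deriveD //; apply: diff_derivable => //.
  exact: differentiable_sumf.
by apply/funext => q; rewrite big_cons.
Qed.

Lemma differentiableMf f h p : differentiable f p -> differentiable h p ->
  differentiable (fun q => f q * h q) p.
Proof. exact: differentiableM. Qed.

Lemma innerE g p (u v : 'rV[R]_n.+1) :
  inner g p u v = \sum_i \sum_j u 0 i * g p i j * v 0 j.
Proof.
rewrite /inner mxE exchange_big; apply: eq_bigr => j _ /=.
by rewrite !mxE big_distrl.
Qed.

Lemma riemannian_unitmx g p : riemannian_metric g -> g p \in unitmx.
Proof.
move=> [_ _ pos]; rewrite -row_free_unit -kermx_eq0; apply/rowV0P => u.
move=> /sub_kermxP ug0; apply/eqP/negP => /negP/(pos p).
by rewrite /inner ug0 mul0mx mxE ltxx.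
Qed.

Lemma christoffelC g k i j p : riemannian_metric g ->
  christoffel g k i j p = christoffel g k j i p.
Proof.
move=> [_ sym _]; rewrite /christoffel; congr (_ * _); apply: eq_bigr => l _.
have gC a b : (fun q => g q a b) = (fun q => g q b a).
  by apply/funext => q; rewrite -[in LHS](sym q) mxE.
by rewrite (gC i j) [X in X - _]addrC.
Qed.

Lemma nabla_torsion_free g X Y p k : riemannian_metric g ->
  (nabla g X Y p - nabla g Y X p) 0 k =
  \sum_i (X p 0 i * partial i (fun q => Y q 0 k) p
          - Y p 0 i * partial i (fun q => X q 0 k) p).
Proof.
move=> gR; rewrite !mxE sumrB opprD addrACA [X in _ + X](_ : _ = 0) ?addr0 //.
apply/eqP; rewrite subr_eq0; apply/eqP; rewrite exchange_big /=.
apply: eq_bigr => i _; apply: eq_bigr => j _.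
by rewrite christoffelC // mulrAC.
Qed.

Lemma christoffel_lower g l i j p : riemannian_metric g ->
  \sum_k g p l k * christoffel g k i j p =
  2^-1 * (partial i (fun q => g q l j) p + partial j (fun q => g q l i) p
          - partial l (fun q => g q i j) p).
Proof.
move=> gR; pose c m := partial i (fun q => g q m j) p
  + partial j (fun q => g q m i) p - partial m (fun q => g q i j) p.
have -> : \sum_k g p l k * christoffel g k i j p =
    2^-1 * (g p *m (invmx (g p) *m \col_m c m)) l 0.
  rewrite mxE big_distrr; apply: eq_bigr => k _ /=.
  rewrite /christoffel mulrCA; congr (_ * (_ * _)).
  by rewrite mxE; apply: eq_bigr => m _; rewrite mxE.
by rewrite mulmxA mulmxV ?mul1mx ?mxE // riemannian_unitmx.
Qed.

Lemma inner_nabla g X Y p (u : 'rV[R]_n.+1) : riemannian_metric g ->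
  inner g p (nabla g X Y p) u =
  \sum_i \sum_a \sum_b X p 0 i *
    (partial i (fun q => Y q 0 a) p * g p a b * u 0 b
     + 2^-1 * (partial i (fun q => g q b a) p + partial a (fun q => g q b i) p
          - partial b (fun q => g q i a) p) * Y p 0 a * u 0 b).
Proof.
move=> gR; have [_ sym _] := gR.
have gC a b : g p a b = g p b a by rewrite -[in LHS](sym p) mxE.
rewrite innerE; under [RHS]eq_bigr do under eq_bigr do under eq_bigr do rewrite mulrDr.
under [RHS]eq_bigr do under eq_bigr do rewrite big_split.
under [RHS]eq_bigr do rewrite big_split.
rewrite [RHS]big_split /=.
under [LHS]eq_bigr do under eq_bigr do rewrite mxE !mulrDl.
under [LHS]eq_bigr do rewrite big_split.
rewrite [LHS]big_split /=; congr (_ + _).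
  rewrite [RHS]exchange_big; apply: eq_bigr => a _ /=.
  rewrite [RHS]exchange_big; apply: eq_bigr => b _ /=.
  by rewrite !big_distrl; apply: eq_bigr => i _ /=; rewrite !mulrA.
under [RHS]eq_bigr do under eq_bigr do under eq_bigr do
  rewrite -christoffel_lower // !big_distrl big_distrr /=.
under [LHS]eq_bigr do under eq_bigr do rewrite !big_distrl /=.
under [LHS]eq_bigr do under eq_bigr do under eq_bigr do rewrite !big_distrl /=.
under [LHS]eq_bigr do rewrite exchange_big /=.
rewrite [LHS]exchange_big /=; apply: eq_bigr => i _.
under [LHS]eq_bigr do rewrite exchange_big /=.
rewrite [LHS]exchange_big /=; apply: eq_bigr => j _.
rewrite [LHS]exchange_big /=; apply: eq_bigr => b _; apply: eq_bigr => a _.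
by rewrite (gC a b); ring.
Qed.

Lemma nabla_metric g X Y Z p : riemannian_metric g ->
  smooth_vfield Y -> smooth_vfield Z ->
  \sum_i X p 0 i * partial i (fun q => inner g q (Y q) (Z q)) p =
  inner g p (nabla g X Y p) (Z p) + inner g p (Y p) (nabla g X Z p).
Proof.
move=> gR sY sZ; have [sg sym _] := gR.
have dg a b : differentiable (fun q => g q a b) p by exact: smooth_differentiable.
have dY a : differentiable (fun q => Y q 0 a) p by exact: smooth_differentiable.
have dZ a : differentiable (fun q => Z q 0 a) p by exact: smooth_differentiable.
have gC q a b : g q a b = g q b a by rewrite -[in LHS](sym q) mxE.
have gC' a b : (fun q => g q a b) = (fun q => g q b a) by apply/funext => q.
have innerC (u v : 'rV[R]_n.+1) : inner g p u v = inner g p v u.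
  rewrite !innerE exchange_big; apply: eq_bigr => a _; apply: eq_bigr => b _ /=.
  by rewrite gC; ring.
rewrite [X in _ + X]innerC !inner_nabla // -big_split /=; apply: eq_bigr => i _.
rewrite [X in _ + X]exchange_big -big_split /=.
have -> : (fun q => inner g q (Y q) (Z q)) =
    (fun q => \sum_a \sum_b Y q 0 a * g q a b * Z q 0 b).
  by apply/funext => q; rewrite innerE.
have dYg a b : differentiable (fun q => Y q 0 a * g q a b) p.
  exact: differentiableMf.
have dYgZ a b : differentiable (fun q => Y q 0 a * g q a b * Z q 0 b) p.
  exact: differentiableMf.
rewrite partial_sum; last by move=> a; exact: differentiable_sumf.
rewrite big_distrr; apply: eq_bigr => a _ /=.
rewrite partial_sum // big_distrr -big_split; apply: eq_bigr => b _ /=.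
rewrite !partialM // (gC' b a) (gC' b i) (gC' i a) (gC p b a).
by field.
Qed.

Lemma differentiable_prodf (I : Type) (r : seq I) (f : I -> 'rV[R]_n.+1 -> R) p :
  (forall i, differentiable (f i) p) ->
  differentiable (fun q => \prod_(i <- r) f i q) p.
Proof.
move=> df; elim: r => [|i r IH].
  rewrite (_ : (fun _ => _) = cst 1) //; last by apply/funext => q; rewrite big_nil.
rewrite (_ : (fun _ => _) = (fun q => f i q * \prod_(j <- r) f j q)).
  exact: differentiableMf.
by apply/funext => q; rewrite big_cons.
Qed.

Lemma differentiable_det m (A : 'rV[R]_n.+1 -> 'M[R]_m) p :
  (forall i j, differentiable (fun q => A q i j) p) ->
  differentiable (fun q => \det (A q)) p.
Proof.
move=> dA; apply: differentiable_sumf => s; apply: differentiableMf => //.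
exact: differentiable_prodf.
Qed.

Lemma differentiable_christoffel g k i j p : riemannian_metric g ->
  differentiable (christoffel g k i j) p.
Proof.
move=> gR; have [sg _ _] := gR.
have dg a b : differentiable (fun q => g q a b) p by exact: smooth_differentiable.
apply: differentiableMf => //; apply: differentiable_sumf => l.
have dpg c a b : differentiable (partial c (fun q => g q a b)) p.
  exact/smooth_differentiable/smooth_partial.
apply: differentiableMf; last first.
  by apply: differentiableB => //; exact: differentiableD.
rewrite (_ : (fun _ => _) =
    (fun q => (\det (g q))^-1 * ((-1) ^+ (l + k) *
                                 \det (row' l (col' k (g q)))))).
  apply: differentiableMf.
    apply: differentiableV; first exact: differentiable_det.
    by have := riemannian_unitmx p gR; rewrite unitmxE unitfE.
  apply: differentiableMf => //; apply: differentiable_det => a b.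
  rewrite (_ : (fun _ => _) = (fun q => g q (lift l a) (lift k b))) //.
  by apply/funext => q; rewrite !mxE.
by apply/funext => q; rewrite /invmx riemannian_unitmx // !mxE.
Qed.

Lemma rough_laplacian_frame g E F V p : riemannian_metric g ->
  orthonormal_frame g E -> orthonormal_frame g F -> smooth_vfield V ->
  rough_laplacian g E V p = rough_laplacian g F V p.
Proof.
move=> gR.
pose N k a q := partial a (fun q => V q 0 k) q
                + \sum_j christoffel g k a j q * V q 0 j.
pose H k a b := \sum_c christoffel g c a b p * N k c p
                - partial b (N k a) p - \sum_c christoffel g k b c p * N c a p.
move=> oE oF sV.
have nablaE X q k : nabla g X V q 0 k = \sum_a X q 0 a * N k a q.
  rewrite mxE -big_split; apply: eq_bigr => a _ /=.
  rewrite mulrDr; congr (_ + _); rewrite big_distrr; apply: eq_bigr => j _ /=.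
  by rewrite mulrA [X in X * _]mulrC.
have dN k a : differentiable (N k a) p.
  apply: differentiableD; first exact/smooth_differentiable/smooth_partial/sV.
  apply: differentiable_sumf => j; apply: differentiableMf.
    exact: differentiable_christoffel.
  exact/smooth_differentiable/sV.
have hess X k : smooth_vfield X ->
    (nabla g (nabla g X X) V p - nabla g X (nabla g X V) p) 0 k =
    \sum_a \sum_b X p 0 a * X p 0 b * H k a b.
  move=> sX.
  have dX a : differentiable (fun q => X q 0 a) p by exact: smooth_differentiable.
  pose P := \sum_a \sum_b X p 0 b * partial b (fun q => X q 0 a) p * N k a p.
  have e1 : nabla g (nabla g X X) V p 0 k = P +
      \sum_a \sum_b X p 0 a * X p 0 b * \sum_c christoffel g c a b p * N k c p.
    rewrite nablaE; under eq_bigr do rewrite mxE mulrDl.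
    rewrite big_split /=; congr (_ + _).
      by apply: eq_bigr => a _; rewrite big_distrl.
    under eq_bigr do rewrite big_distrl /=.
    under eq_bigr do under eq_bigr do rewrite big_distrl /=.
    rewrite exchange_big; apply: eq_bigr => a _ /=.
    rewrite exchange_big; apply: eq_bigr => b _ /=.
    by rewrite big_distrr; apply: eq_bigr => c _ /=; ring.
  have e2 : nabla g X (nabla g X V) p 0 k = P +
      \sum_a \sum_b X p 0 a * X p 0 b *
        (partial b (N k a) p + \sum_c christoffel g k b c p * N c a p).
    rewrite mxE.
    have -> : (fun q => nabla g X V q 0 k) = (fun q => \sum_a X q 0 a * N k a q).
      by apply/funext => q; rewrite nablaE.
    under eq_bigr => b _.
      rewrite partial_sum; last by move=> a; exact: differentiableMf.
      rewrite big_distrr; under eq_bigr do rewrite /= partialM // mulrDr.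
      rewrite big_split /=; over.
    rewrite big_split /= -addrA; congr (_ + _).
      rewrite exchange_big; apply: eq_bigr => a _; apply: eq_bigr => b _ /=.
      by rewrite mulrA.
    rewrite [RHS]exchange_big -big_split; apply: eq_bigr => b _ /=.
    under [X in _ + X]eq_bigr do rewrite nablaE big_distrr /=.
    rewrite [X in _ + X]exchange_big -big_split; apply: eq_bigr => a _ /=.
    rewrite mulrDr; congr (_ + _); first by ring.
    by rewrite big_distrr; apply: eq_bigr => c _ /=; ring.
  rewrite mxE [X in _ + X]mxE e1 e2 opprD addrACA subrr add0r -sumrB.
  apply: eq_bigr => a _; rewrite -sumrB; apply: eq_bigr => b _.
  by rewrite /H -mulrBr opprD addrA.
have gram G : orthonormal_frame g G -> forall a b,
    \sum_i G i p 0 a * G i p 0 b = invmx (g p) a b.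
  move=> [_ oG] a b; pose M := \matrix_i G i p.
  have MgM : M *m (g p *m M^T) = 1%:M.
    apply/matrixP => i j; rewrite mxE [RHS]mxE -(oG p) innerE exchange_big /=.
    rewrite [RHS]exchange_big; apply: eq_bigr => l _ /=.
    rewrite !mxE big_distrr; apply: eq_bigr => m _ /=.
    by rewrite !mxE mulrA.
  have gMM : g p *m (M^T *m M) = 1%:M by rewrite mulmxA; exact: mulmx1C.
  transitivity ((M^T *m M) a b).
    by rewrite mxE; apply: eq_bigr => i _; rewrite !mxE.
  by rewrite -[M^T *m M](mulKmx (riemannian_unitmx p gR)) gMM mulmx1.
have lapE G k : orthonormal_frame g G -> rough_laplacian g G V p 0 k =
    \sum_a \sum_b invmx (g p) a b * H k a b.
  move=> oG; rewrite /rough_laplacian summxE.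
  under eq_bigr do rewrite (hess _ _ (oG.1 _)).
  rewrite exchange_big; apply: eq_bigr => a _ /=.
  rewrite exchange_big; apply: eq_bigr => b _ /=.
  by rewrite -(gram G) // big_distrl.
by apply/rowP => k; rewrite !lapE.
Qed.

End Geometry.

(* The coordinates x^1, x^2, x^3 of p : 'rV[R]_3 are p 0 0, p 0 1 and p 0 2. *)
Section Sol3.
Context {R : realType}.

Definition sol_metric : metric R 2 := fun p =>
  diag_mx (\row_i [:: expR (2 * p 0 2); expR (- 2 * p 0 2); 1]`_i).

Definition sol_frame : frame R 2 := fun i p =>
  [:: expR (- p 0 2); expR (p 0 2); 1]`_i *: delta_mx 0 i.

Definition sol_left_invariant (x y z : R) : vfield R 2 := fun p =>
  x *: sol_frame 0 p + y *: sol_frame 1 p + z *: sol_frame 2 p.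

Lemma smooth_expR (c a : R) (k : 'I_3) :
  smooth (fun p : 'rV[R]_3 => c * expR (a * p 0 k)).
Proof.
have de (b : R) p :
    differentiable (fun q : 'rV[R]_3 => b * expR (a * q 0 k)) p.
  apply: differentiableMf => //; apply: differentiable_comp => //.
    by apply: differentiableMf => //; exact: differentiable_coord.
  exact/derivable1_diffP/derivable_expR.
move=> s p.
suff [b ->] : exists b, foldr partial (fun p => c * expR (a * p 0 k)) s =
    fun p => b * expR (a * p 0 k) by exact: de.
elim: s => [|i s [b IH]]; first by exists c.
exists (b * a * (i == k)%:R); apply/funext => q /=; rewrite IH.
rewrite /partial.
pose F (p' : 'rV[R]_3) := b * expR (a * p' 0 k).
pose G (t : R) := b * expR (a * (t * (i == k)%:R + q 0 k)).
rewrite -/F (_ : 'D_(delta_mx 0 i) F q = 'D_(1 : R) G 0); last first.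
  rewrite /derive (_ : (fun h => _) =
      (fun h => h^-1 *: ((G \o shift 0) (h *: 1) - G 0))) //.
  apply/funext => h; rewrite /F /G /= !mxE eqxx /= addr0 [_%:A]mulr1 mul0r add0r.
  by rewrite eq_sym.
have -> : G = b \*: (expR \o ((a * (i == k)%:R) \*: id + cst (a * q 0 k))).
  by apply/funext => t; rewrite /G /= fctE /=; congr (_ * expR _); rewrite /GRing.scale /=; ring.
have dl : is_derive (0 : R) (1 : R)
    ((a * (i == k)%:R) \*: id + cst (a * q 0 k)) ((a * (i == k)%:R) *: 1 + 0).
  by apply: is_deriveD.
have dc := is_derive1_comp (is_derive_expR _) dl.
have dz := is_deriveZ b dc.
rewrite derive_val fctE /= /GRing.scale /= mulr0 add0r; ring.
Qed.

Lemma sol_frame_orthonormal : orthonormal_frame sol_metric sol_frame.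
Proof.
split=> [i k|p i j].
  rewrite /sol_frame; case: i => -[|[|[|//]]] ilt /=.
  - rewrite (_ : (fun _ => _) =
      (fun p : 'rV[R]_3 => (k == 0)%:R * expR (-1 * p 0 2))).
      exact: smooth_expR.
    by apply/funext => p; rewrite !mxE eqxx /= mulN1r mulrC.
  - rewrite (_ : (fun _ => _) =
      (fun p : 'rV[R]_3 => (k == 1)%:R * expR (1 * p 0 2))).
      exact: smooth_expR.
    by apply/funext => p; rewrite !mxE eqxx /= mul1r mulrC.
  - rewrite (_ : (fun _ => _) =
      (fun p : 'rV[R]_3 => (k == 2)%:R * expR (0 * p 0 2))).
      exact: smooth_expR.
    by apply/funext => p; rewrite !mxE eqxx /= mul0r expR0 mulrC.
rewrite /inner /sol_metric mul_mx_diag mxE (bigD1 i) //= big1 => [|k ki].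
  rewrite addr0 /sol_frame !mxE !eqxx /= mulr1 [i == j]eq_sym.
  case: (eqVneq j i) => [->|_]; last by rewrite !mulr0.
  rewrite mulr1; case: i => -[|[|[|//]]] ilt /=; rewrite ?mulr1 // -!expRD -[RHS]expR0.
    by congr expR; ring.
  by congr expR; ring.
by rewrite /sol_frame !mxE (negPf ki) mulr0 !mul0r.
Qed.

Lemma sol_metric_riemannian : riemannian_metric sol_metric.
Proof.
split=> [i j|p|p u u0].
- rewrite /sol_metric; case: (eqVneq i j) => [<-|/negPf ij]; last first.
    rewrite (_ : (fun _ => _) = (fun p : 'rV[R]_3 => 0 * expR (0 * p 0 2))).
      exact: smooth_expR.
    by apply/funext => p; rewrite !mxE ij mul0r.
  rewrite (_ : (fun _ => _) =
    (fun p : 'rV[R]_3 => 1 * expR ([:: 2; - 2; 0]`_i * p 0 2))).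
    exact: smooth_expR.
  apply/funext => p; rewrite !mxE eqxx mul1r mulr1n.
  by case: i => -[|[|[|//]]] ilt //=; rewrite mul0r expR0.
- exact: tr_diag_mx.
- rewrite /inner /sol_metric mul_mx_diag mxE.
  have d0 (i : 'I_3) : 0 < [:: expR (2 * p 0 2); expR (- 2 * p 0 2); 1]`_i.
    by case: i => -[|[|[|//]]] ilt /=; rewrite ?expR_gt0 ?ltr01.
  have /rV0Pn[i ui] := u0.
  have E j : (\matrix_(i0, j0) (u i0 j0 * (\row_i [:: expR (2 * p 0 2); expR (- 2 * p 0 2); 1]`_i) 0 j0)) 0 j * u^T j 0
     = [:: expR (2 * p 0 2); expR (- 2 * p 0 2); 1]`_j * u 0 j ^+ 2.
    by rewrite !mxE expr2; ring.
  rewrite (bigD1 i) //= E; apply: ltr_wpDr.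
    by apply: sumr_ge0 => j _; rewrite E mulr_ge0 ?sqr_ge0 // ltW.
  by rewrite mulr_gt0 // lt_def sqrf_eq0 ui sqr_ge0.
Qed.

End Sol3.

(* Main.v *)
(** In the left-invariant frame [nabla] has constant coefficients: the covariant
    derivative of [b] along [a] is [(a1 b3, - a2 b3, a2 b2 - a1 b1)].  Hence the
    rough Laplacian maps left-invariant fields to left-invariant ones by
    [(x, y, z) |-> (x, y, 2 z)].  With [f = g(DV, V) = 1 + z^2] the biharmonic
    field is [((1 - 2 f) x, (1 - 2 f) y, (4 - 4 f) z)], which is collinear to [V]
    outside the harmonic cases exactly when [1 - 2 f = 4 - 4 f], i.e. when
    [z^2 = 1/2]. *)

From HB Require Import structures.
Require Import Defs.
From mathcomp Require Import all_boot all_order all_algebra.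
From mathcomp Require Import all_classical all_reals all_analysis.
From mathcomp Require Import ring lra.

Import Order.TTheory GRing.Theory Num.Theory.
Import numFieldNormedType.Exports.
Local Open Scope ring_scope.

Lemma invmx_diag (F : fieldType) (n : nat) (d : 'rV[F]_n) :
  (forall i, d 0 i != 0) -> invmx (diag_mx d) = diag_mx (map_mx GRing.inv d).
Proof.
move=> d0; have dV : diag_mx d *m diag_mx (map_mx GRing.inv d) = 1%:M.
  rewrite mulmx_diag -diag_const_mx; congr diag_mx.
  by apply/rowP => i; rewrite !mxE divff.
have [du _] := mulmx1_unit dV.
by rewrite -[LHS]mulmx1 -dV mulKmx.
Qed.

(** The chain rule. Metric coefficients and components of left-invariant fields all have this
    exponential shape, so this is the only derivative to compute. *)
Lemma partial_expR (R : realType) (n : nat) (c a : R) (i k : 'I_n.+1)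
    (p : 'rV[R]_n.+1) :
  partial i (fun q => c * expR (a * q 0 k)) p =
  (i == k)%:R * (c * a * expR (a * p 0 k)).
Proof.
pose f (q : 'rV[R]_n.+1) := q 0 k.
pose h (t : R) := c * expR (a * t).
(* A coordinate is linear and continuous, hence its own differential; the linear structure is packed
   by hand for [diff_lin]. *)
have fE q : is_diff q f f.
  have flin : linear f by move=> b u v; rewrite /f !mxE.
  pose F := GRing.isLinear.Build _ _ _ _ f flin.
  pose G : {linear 'rV[R]_n.+1 -> R^o} := HB.pack f F.
  have df : differentiable f q by exact: differentiable_coord.
  by apply: DiffDef => //; exact: (@diff_lin _ _ _ G q (@coord_continuous _ _ _ _ _)).
have hE (t : R) : is_derive t 1 h (c * a * expR (a * t)).
  rewrite (_ : h = c \*: (expR \o (a \*: id))) //.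
  apply: is_derive_eq; rewrite /GRing.scale /= mulr1; ring.
rewrite -[LHS]/('D_(delta_mx 0 i) (h \o f) p).
have dh t : differentiable h t by apply/derivable1_diffP; apply: ex_derive.
rewrite deriveE; last exact: differentiable_comp.
rewrite diff_comp //= diff_val diff1E // derive1E derive_val /f !mxE /=.
by rewrite eq_sym.
Qed.

(** * Sol metric and connection in coordinates *)

Section LeftInvariant.
Context {R : realType}.
Implicit Types (x y z : R) (p : 'rV[R]_3).

Lemma sol_left_invariantE x y z p (k : 'I_3) :
  sol_left_invariant x y z p 0 k =
  [:: x; y; z]`_k * expR ([:: -1; 1; 0]`_k * p 0 2).
Proof.
rewrite !mxE; case: k => -[|[|[|//]]] lt /=; rewrite !(mulr0, mulr1, add0r, addr0).
- by rewrite mulN1r.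
- by rewrite mul1r.
- by rewrite mul0r expR0 mulr1.
Qed.

(** Growth rates in [x^3] of the diagonal metric coefficients; the rate 0 lets the constant
    coefficient 1 share the exponential form. *)
Definition sol_exponent (k : 'I_3) : R := [:: 2; -2; 0]`_k.

Lemma sol_metricE p (i j : 'I_3) :
  sol_metric p i j = (i == j)%:R * expR (sol_exponent i * p 0 2).
Proof.
rewrite !mxE [RHS]mulr_natl /sol_exponent; congr (_ *+ _).
by case: i => -[|[|[|//]]] lt /=; rewrite // mul0r expR0.
Qed.

Lemma invmx_sol_metric p (i j : 'I_3) :
  invmx (sol_metric p) i j = (i == j)%:R * expR (- (sol_exponent i * p 0 2)).
Proof.
have gE : sol_metric p = diag_mx (\row_k expR (sol_exponent k * p 0 2)).
  by apply/matrixP => a b; rewrite sol_metricE !mxE mulr_natl.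
rewrite gE invmx_diag => [|k]; last by rewrite mxE expR_eq0.
by rewrite !mxE expRN mulr_natl.
Qed.

(** The metric is diagonal, so only [l = k] contributes, and it depends on [x^3] alone, so only
    derivatives in direction [2] survive. The disjunction may count [i = j = k = 2] once because the
    exponent vanishes there. *)
Lemma sol_christoffel p (k i j : 'I_3) :
  christoffel sol_metric k i j p =
  2^-1 * (sol_exponent k * ((i == 2) && (j == k) || (j == 2) && (i == k))%:R
    - ((k == 2) && (i == j))%:R * sol_exponent i * expR (sol_exponent i * p 0 2)).
Proof.
have pg (l a b : 'I_3) : partial l (fun q => sol_metric q a b) p =
    (l == 2)%:R * (a == b)%:R * sol_exponent a * expR (sol_exponent a * p 0 2).
  under eq_fun do rewrite sol_metricE.
  by rewrite partial_expR !mulrA.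
rewrite /christoffel (bigD1 k) //= big1 => [|l lk]; last first.
  by rewrite invmx_sol_metric eq_sym (negPf lk) !mul0r.
rewrite addr0 invmx_sol_metric eqxx !pg mul1r -mulrA; congr (_ * _).
rewrite expRN; have e0 l : expR (sol_exponent l * p 0 2) != 0 by rewrite expR_eq0.
(* Put in the goal so that the case split on [k] specializes the nonvanishing fact that [field]
   needs. *)
move: (e0 k); rewrite /sol_exponent.
case: k => -[|[|[|//]]] klt; case: i => -[|[|[|//]]] ilt;
  case: j => -[|[|[|//]]] jlt /= k0; rewrite ?mul0r ?expR0; by field.
Qed.

(** Turns every exponential in sight into a power of [expR t], so that [field] can finish. *)
Lemma expR_weights (t : R) :
  [/\ expR (-1 * t) = (expR t)^-1, expR (2 * t) = expR t ^+ 2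
    & expR (-2 * t) = (expR t)^-1 ^+ 2].
Proof. by split; rewrite ?mulNr ?mul1r ?expRN ?expRM_natl ?exprVn. Qed.

(** Differentiating the components along [e_3] cancels the Christoffel terms containing [a3], hence
    its absence on the right. *)
Lemma nabla_sol_left_invariant (a1 a2 a3 b1 b2 b3 : R) :
  nabla sol_metric (sol_left_invariant a1 a2 a3) (sol_left_invariant b1 b2 b3) =
  sol_left_invariant (a1 * b3) (- (a2 * b3)) (a2 * b2 - a1 * b1).
Proof.
apply/funext => p; apply/rowP => k; rewrite mxE.
have pb (i : 'I_3) :
    partial i (fun q => sol_left_invariant b1 b2 b3 q 0 k) p = (i == 2)%:R *
    ([:: b1; b2; b3]`_k * [:: -1; 1; 0]`_k * expR ([:: -1; 1; 0]`_k * p 0 2)).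
  by under eq_fun do rewrite sol_left_invariantE; exact: partial_expR.
rewrite !big_ord_recl !big_ord0 !pb !sol_christoffel !sol_left_invariantE /sol_exponent.
have [eN e2 eN2] := expR_weights (p 0 2).
have e0 : expR (p 0 2) != 0 by rewrite expR_eq0.
case: k {pb} => -[|[|[|//]]] klt /=;
  rewrite ?eN ?eN2 ?e2 ?(mul1r (p 0 2)) ?(mul0r (p 0 2)) ?expR0; by field.
Qed.

(** * Algebra of left-invariant fields and their rough Laplacian *)

Lemma sol_left_invariantD (a b c x y z : R) p :
  sol_left_invariant a b c p + sol_left_invariant x y z p =
  sol_left_invariant (a + x) (b + y) (c + z) p.
Proof. by rewrite /sol_left_invariant !scalerDl addrACA [X in X + _]addrACA. Qed.

Lemma sol_left_invariantZ (k x y z : R) p :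
  k *: sol_left_invariant x y z p = sol_left_invariant (k * x) (k * y) (k * z) p.
Proof. by rewrite /sol_left_invariant !scalerDr !scalerA. Qed.

Lemma sol_left_invariantB (a b c x y z : R) p :
  sol_left_invariant a b c p - sol_left_invariant x y z p =
  sol_left_invariant (a - x) (b - y) (c - z) p.
Proof. by rewrite -scaleN1r sol_left_invariantZ sol_left_invariantD !mulN1r. Qed.

Lemma sol_left_invariant_inj (a b c x y z : R) p :
  sol_left_invariant a b c p = sol_left_invariant x y z p ->
  [/\ a = x, b = y & c = z].
Proof.
move=> /rowP E; have e0 t : expR t != 0 :> R by rewrite expR_eq0.
by split; [have := E 0 | have := E 1 | have := E 2];
  rewrite !sol_left_invariantE => /(mulIf (e0 _)).
Qed.

Lemma sol_frameE (i : 'I_3) :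
  sol_frame (R := R) i = sol_left_invariant (i == 0)%:R (i == 1)%:R (i == 2)%:R.
Proof.
apply/funext => p; rewrite /sol_left_invariant.
case: i => -[|[|[|//]]] lt /=; rewrite ?scale0r ?scale1r ?add0r ?addr0;
  by congr (sol_frame _ p); apply/val_inj.
Qed.

Lemma inner_sol_left_invariant (a b c x y z : R) p :
  inner sol_metric p (sol_left_invariant a b c p) (sol_left_invariant x y z p) =
  a * x + b * y + c * z.
Proof.
rewrite innerE !big_ord_recl !big_ord0 !sol_metricE !sol_left_invariantE /sol_exponent /=.
have [eN e2 eN2] := expR_weights (p 0 2).
have e0 : expR (p 0 2) != 0 by rewrite expR_eq0.
by rewrite eN eN2 e2 (mul1r (p 0 2)) !(mul0r (p 0 2)) !expR0; field.
Qed.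

(** Each [nabla e_i e_i] is a multiple of [e_3], along which left-invariant fields are parallel, so
    only the second-order terms remain: [e_1] gives [(x, 0, z)], [e_2] gives [(0, y, z)], [e_3]
    gives 0. *)
Lemma rough_laplacian_sol (x y z : R) :
  rough_laplacian sol_metric sol_frame (sol_left_invariant x y z) =
  sol_left_invariant x y (2 * z).
Proof.
apply/funext => p; rewrite /rough_laplacian !big_ord_recl big_ord0.
rewrite !sol_frameE !nabla_sol_left_invariant !sol_left_invariantB addr0 !sol_left_invariantD.
by congr sol_left_invariant => /=; ring.
Qed.

(** The factor may a priori vary with the point; since the coefficients are constant, its value at
    the origin works everywhere. *)
Lemma collinear_sol_left_invariant (a b c x y z : R) :
  collinear_to (sol_left_invariant a b c) (sol_left_invariant x y z) <->
  exists k, [/\ a = k * x, b = k * y & c = k * z].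
Proof.
split=> [/(_ 0)[k]|[k [-> -> ->]] p]; last by exists k; rewrite sol_left_invariantZ.
by rewrite sol_left_invariantZ => /sol_left_invariant_inj ?; exists k.
Qed.

(** * The harmonic and biharmonic equations on constants *)

Lemma unit_sol_left_invariant x y z : x ^+ 2 + y ^+ 2 + z ^+ 2 = 1 ->
  unit_vfield sol_metric (sol_left_invariant x y z).
Proof.
move=> xyz1; split=> [k|p]; last by rewrite inner_sol_left_invariant -!expr2.
rewrite (_ : (fun _ => _) =
    fun p => [:: x; y; z]`_k * expR ([:: -1; 1; 0]`_k * p 0 2)).
  exact: smooth_expR.
by apply/funext => p; rewrite sol_left_invariantE.
Qed.

Lemma harmonic_sol_left_invariant x y z : x ^+ 2 + y ^+ 2 + z ^+ 2 = 1 ->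
  harmonic_unit_section sol_metric sol_frame (sol_left_invariant x y z) <->
  x = 0 /\ y = 0 \/ z = 0.
Proof.
move=> xyz1; rewrite /harmonic_unit_section rough_laplacian_sol.
rewrite collinear_sol_left_invariant; split=> [[_ [k [xk yk zk]]]|xyz0].
  have [->|z0] := eqVneq z 0; [by right | left].
  have k2 : k = 2 by apply/esym/(mulIf z0).
  by move: xk yk; rewrite k2 => xk yk; split; lra.
split; first exact: unit_sol_left_invariant.
by case: xyz0 => [[-> ->]|->]; [exists 2 | exists 1]; split; ring.
Qed.

Lemma biharmonic_sol_left_invariant x y z : x ^+ 2 + y ^+ 2 + z ^+ 2 = 1 ->
  biharmonic_unit_section sol_metric sol_frame (sol_left_invariant x y z) <->
  [\/ x = 0 /\ y = 0, z = 0 | z ^+ 2 = 1 / 2].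
Proof.
move=> xyz1; rewrite /biharmonic_unit_section rough_laplacian_sol.
pose f := 1 + z ^+ 2.
have fE p : inner sol_metric p (sol_left_invariant x y (2 * z) p)
    (sol_left_invariant x y z p) = f.
  by rewrite inner_sol_left_invariant /f; lra.
(* As [f] is constant, the inner field is again left-invariant and [rough_laplacian_sol] applies a
   second time. *)
have WE : (fun q => sol_left_invariant x y (2 * z) q -
      inner sol_metric q (sol_left_invariant x y (2 * z) q)
        (sol_left_invariant x y z q) *: sol_left_invariant x y z q) =
    sol_left_invariant ((1 - f) * x) ((1 - f) * y) ((2 - f) * z).
  apply/funext => q; rewrite fE sol_left_invariantZ sol_left_invariantB.
  by congr (sol_left_invariant _ _ _ q); ring.
rewrite WE rough_laplacian_sol (_ : (fun p => _ - _) = sol_left_invariant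
    ((1 - 2 * f) * x) ((1 - 2 * f) * y) ((4 - 4 * f) * z)); last first.
  apply/funext => q; rewrite fE sol_left_invariantZ sol_left_invariantB.
  by congr (sol_left_invariant _ _ _ q); ring.
rewrite collinear_sol_left_invariant; split=> [[_ [k [xk yk zk]]]|xyz0].
  have [z0|z0] := eqVneq z 0; first by constructor 2.
  (* Here [z != 0] forces [k = 4 - 4 * f], and a nonzero [x] or [y] forces [k = 1 - 2 * f]; together
     [f = 3 / 2]. *)
  have [x0|x0] := eqVneq x 0.
    have [y0|y0] := eqVneq y 0; first by constructor 1.
    by constructor 3; have := mulIf z0 zk; have := mulIf y0 yk; rewrite /f; lra.
  by constructor 3; have := mulIf z0 zk; have := mulIf x0 xk; rewrite /f; lra.
split; first exact: unit_sol_left_invariant.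
(* The factor is read off the components that survive; for [z ^+ 2 = 1 / 2] both candidates equal
   -2. *)
case: xyz0 => [[-> ->]|->|z2].
- by exists (4 - 4 * f); split; ring.
- by exists (1 - 2 * f); split; ring.
- by exists (1 - 2 * f); rewrite /f z2; split; field.
Qed.

End LeftInvariant.

Theorem theorem3p2 (R : realType) (x y z : R)
    (xyz1 : x ^+ 2 + y ^+ 2 + z ^+ 2 = 1) :
  let V := sol_left_invariant x y z in
  let harmonic := harmonic_unit_section sol_metric sol_frame V in
  let biharmonic := biharmonic_unit_section sol_metric sol_frame V in
  (harmonic <->
     (V = sol_frame 2 \/ V = (fun p => - sol_frame 2 p)) \/
     (forall p, inner sol_metric p (V p) (sol_frame 2 p) = 0))
  /\
  (biharmonic /\ ~ harmonic <->
     (z = 1 / Num.sqrt 2 /\ x ^+ 2 + y ^+ 2 = 1 / 2) \/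
     (z = - (1 / Num.sqrt 2) /\ x ^+ 2 + y ^+ 2 = 1 / 2)).
Proof.
move=> V harmonic biharmonic.
have hE : harmonic <-> x = 0 /\ y = 0 \/ z = 0.
  exact: harmonic_sol_left_invariant.
have bE : biharmonic <-> [\/ x = 0 /\ y = 0, z = 0 | z ^+ 2 = 1 / 2].
  exact: biharmonic_sol_left_invariant.
split.
  have E3 : sol_frame 2 = sol_left_invariant 0 0 1 :> vfield R 2.
    exact: sol_frameE.
  have E3N : (fun p => - sol_frame 2 p) = sol_left_invariant 0 0 (-1) :> vfield R 2.
    apply/funext => p; rewrite E3 -scaleN1r sol_left_invariantZ.
    by rewrite !mulr0 mulr1.
  rewrite hE E3N E3 /V; split=> [[[x0 y0]|z0]|[VE|ip]].
  - left; have : (z == 1) || (z == -1).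
      by rewrite -sqrf_eq1 -xyz1 x0 y0 expr0n !add0r.
    by rewrite x0 y0 => /orP[]/eqP ->; [left | right].
  - by right=> p; rewrite inner_sol_left_invariant z0; ring.
  (* Comparing the fields at the origin already determines the constants. *)
  - by left; case: VE => /(congr1 (fun W => W 0)) /sol_left_invariant_inj[].
  - by right; have := ip 0; rewrite inner_sol_left_invariant !mulr0 !add0r mulr1.
rewrite hE bE.
have zE : z ^+ 2 = 1 / 2 <-> z = 1 / Num.sqrt 2 \/ z = - (1 / Num.sqrt 2).
  have s2 : (1 / Num.sqrt 2) ^+ 2 = 1 / 2 :> R.
    by rewrite expr_div_n expr1n sqr_sqrtr.
  split=> [z2|[->|->]]; rewrite ?sqrrN //.
  have : (z == 1 / Num.sqrt 2) || (z == - (1 / Num.sqrt 2)).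
    by rewrite -eqf_sqr s2 z2.
  by case/orP => /eqP ->; [left | right].
split=> [[[xy0|z0|z2] nh]|h].
- by case: nh; left.
- by case: nh; right.
- have xy : x ^+ 2 + y ^+ 2 = 1 / 2 by lra.
  by case/zE: z2 => ->; [left | right].
- have z2 : z ^+ 2 = 1 / 2 by apply/zE; case: h => -[-> _]; [left | right].
  split; first by constructor 3.
  (* Either harmonic case contradicts [z2]: [x = y = 0] would give [z ^+ 2 = 1], and [z = 0] would
     give 0. *)
  case=> [[x0 y0]|z0].
    by move: xyz1; rewrite x0 y0 z2 expr0n /=; lra.
  by move: z2; rewrite z0 expr0n /=; lra.
Qed.
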